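(* If a forcing $\mathbb{P}$ is strongly ssp, then $\mathbb{P}$ does not add any fresh functions $\omega_1\to V$; that is, for every $V$-generic filter $G\subseteq\mathbb{P}$ and every function $f:\omega_1^V\to V$ in $V[G]$ such that $f\upharpoonright\alpha\in V$ for all $\alpha<\omega_1^V$, one has $f\in V$.
   Context: For a set $X$ and a cardinal $\theta$, $X\ll\theta$ means $\mathscr{P}(\mathscr{P}(X))\in H_\theta$. For a countable $M\prec H_\theta$ ($\theta$ regular uncountable) and $x\in\bigcup M$, let $\mathrm{Hull}(M,x)=\{f(x): f\in M \text{ a function}, x\in\mathrm{dom}(f)\}$, and write $x\parallel_{\omega_1}M$ if $\mathrm{Hull}(M,x)\cap\omega_1=M\cap\omega_1$. A set $Z\subseteq[H_\theta]^\omega$ is projective stationary if for every stationary $S\subseteq\omega_1$ the set $\{M\in Z: M\cap\omega_1\in S\}$ is stationary in $[H_\theta]^\omega$. For conditions $r,q$ in a forcing, $r\parallel q$ means they are compatible. Let $\mathbb{P}$ be a forcing, $\theta\gg\mathbb{P}$ regular and $M\prec H_\theta$ countable with $\mathbb{P}\in M$. A condition $p^*\in\mathbb{P}$ is strongly $(M,\mathbb{P})$-semigeneric if for every $q\le p^*$ there is a condition $\mathrm{tr}(q|M)\in\mathbb{P}$ such that $\mathrm{tr}(q|M)\parallel_{\omega_1}M$ and for every $r\in\mathrm{Hull}(M,\mathrm{tr}(q|M))\cap\mathbb{P}$, $r\le\mathrm{tr}(q|M)$ implies $r\parallel q$. $\mathbb{P}$ is strongly semiproper with respect to $M$ if for every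 $p\in\mathbb{P}\cap M$ there is a strongly $(M,\mathbb{P})$-semigeneric $p^*\le p$. $\mathbb{P}$ is strongly ssp if for every sufficiently large regular cardinal $\theta$ ($\theta\gg\mathbb{P}$) there exist projective stationary many countable $M\prec H_\theta$ such that $\mathbb{P}$ is strongly semiproper with respect to $M$. *)

(* Defs.v *)
From HB Require Import structures.
From mathcomp Require Import all_boot.
From mathcomp Require Import mathcomp_extra boolp classical_sets functions cardinality.
From Stdlib Require Import Relation_Operators.

Set Implicit Arguments.
Unset Strict Implicit.
Unset Printing Implicit Defensive.

Local Open Scope classical_set_scope.
Local Open Scope card_scope.
Local Open Scope quotient_scope.

(** [V] is Aczel's type of well-founded trees quotiented by bisimilarity, so
    that [=] on [V] is set equality.  With the classical axioms of [boolp] it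
    is a model of ZFC in which Replacement and Separation hold for arbitrary
    Rocq functions and predicates; consequently a Rocq-level subset of a set,
    a countable subset of [V], or a bijection between two sets is always
    (coded by) an element of [V], and external and internal cardinalities
    agree.  Subclasses of [V] are written [set V].

    [small] fixes the universe level of index types once and for all: sets and
    forcing names are indexed by types of the same size. *)
Definition small := Type.

Inductive pset : Type := PSet (A : small) (f : A -> pset).

Fixpoint peq (x y : pset) {struct x} : Prop :=
  let: PSet A f := x in
  let: PSet B g := y in
  (forall a, exists b, peq (f a) (g b)) /\ (forall b, exists a, peq (f a) (g b)).

Lemma peq_refl x : peq x x.
Proof. by elim: x => A f IH /=; split=> a; exists a. Qed.

Lemma peq_sym x y : peq x y -> peq y x.
Proof.
elim: x y => A f IH [B g] /= [h1 h2]; split=> [b|a].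
  by have [a /IH] := h2 b; exists a.
by have [b /IH] := h1 a; exists b.
Qed.

Lemma peq_trans x y z : peq x y -> peq y z -> peq x z.
Proof.
elim: x y z => A f IH [B g] [C h] /= [h1 h2] [h3 h4]; split=> [a|c].
  by have [b /IH ab] := h1 a; have [c /ab] := h3 b; exists c.
by have [b bc] := h4 c; have [a /IH ab] := h2 b; exists a; apply: ab.
Qed.

HB.instance Definition _ := gen_eqMixin pset.
HB.instance Definition _ := gen_choiceMixin pset.

Definition peqb : rel pset := fun x y => `[< peq x y >].

Lemma peqb_refl : reflexive peqb.
Proof. by move=> x; apply/asboolP/peq_refl. Qed.

Lemma peqb_sym : symmetric peqb.
Proof. by move=> x y; apply/asboolP/asboolP; apply: peq_sym. Qed.

Lemma peqb_trans : transitive peqb.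
Proof. by move=> y x z /asboolP xy /asboolP yz; apply/asboolP/(peq_trans xy). Qed.

Canonical peq_equiv := EquivRel peqb peqb_refl peqb_sym peqb_trans.

Definition V := {eq_quot peq_equiv}.
HB.instance Definition _ := Choice.on V.
HB.instance Definition _ := EqQuotient.on V.

Definition pidx (x : pset) : small := let: PSet A _ := x in A.
Definition pelt (x : pset) : pidx x -> pset :=
  let: PSet _ f := x in f.

Definition idx (x : V) : small := pidx (repr x).
Definition elt (x : V) (i : idx x) : V := \pi_V (pelt i).

Definition mem (x y : V) : Prop := exists i : idx y, elt i = x.
Notation "x ∈ y" := (mem x y) (at level 70).

Definition elts (x : V) : set V := [set y | y ∈ x].

Definition upair (a b : V) : V :=
  \pi_V (PSet (fun c : bool => if c then repr a else repr b)).
Definition opair (a b : V) : V := upair (upair a a) (upair a b).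

Definition pow (x : V) : V :=
  \pi_V (PSet (fun S : idx x -> Prop =>
    PSet (fun i : {i : idx x | S i} => pelt (proj1_sig i)))).

Lemma pi_peq x y : \pi_V x = \pi_V y <-> peq x y.
Proof.
split; first by move/eqP; rewrite piE => /asboolP.
by move=> xy; apply/eqP; rewrite piE; apply/asboolP.
Qed.

Lemma peq_repr x : peq (repr (\pi_V x)) x.
Proof. by apply/pi_peq; rewrite reprK. Qed.

Lemma mem_pi (x : V) (A : small) (f : A -> pset) :
  x ∈ \pi_V (PSet f) <-> exists a, \pi_V (f a) = x.
Proof.
rewrite /mem /elt /idx; have := peq_repr (PSet f).
case: (repr _) => B g /= [h1 h2]; split=> [[b <-]|[a <-]].
  by have [a ab] := h1 b; exists a; apply/pi_peq/peq_sym.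
by have [b ab] := h2 a; exists b; apply/pi_peq.
Qed.

Lemma V_ext (x y : V) : (forall z, z ∈ x <-> z ∈ y) -> x = y.
Proof.
rewrite -[x]reprK -[y]reprK; case: (repr x) (repr y) => A f [B g] h.
apply/pi_peq; split=> [a|b].
  have /h/mem_pi[b /pi_peq ba] : \pi_V (f a) ∈ \pi_V (PSet f).
    by apply/mem_pi; exists a.
  by exists b; apply: peq_sym.
have /h/mem_pi[a /pi_peq ab] : \pi_V (g b) ∈ \pi_V (PSet g).
  by apply/mem_pi; exists b.
by exists a.
Qed.

Lemma mem_wf : well_founded mem.
Proof.
move=> x; rewrite -[x]reprK; elim: (repr x) => A f IH.
by constructor=> y /mem_pi[a <-].
Qed.

Lemma mem_upair (x a b : V) : x ∈ upair a b <-> x = a \/ x = b.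
Proof.
split=> [/mem_pi[[] <-]|[->|->]]; rewrite ?reprK; [by left|by right| |];
  apply/mem_pi; [exists true|exists false]; by rewrite reprK.
Qed.

Lemma mem_pow (x y : V) : y ∈ pow x <-> elts y `<=` elts x.
Proof.
split=> [/mem_pi[S <-] z /mem_pi[[i Si] <-]|yx]; first by exists i.
apply/mem_pi; exists (fun i => elt i ∈ y); apply: V_ext => z; split.
  by move=> /mem_pi[[i iy] <-].
move=> zy; have [i iz] := yx _ zy; apply/mem_pi.
by have iy : elt i ∈ y by [rewrite iz]; exists (exist _ i iy).
Qed.

Definition transitive_set (x : V) : Prop := forall y, y ∈ x -> elts y `<=` elts x.

Definition ordinal (x : V) : Prop :=
  transitive_set x /\ forall y, y ∈ x -> transitive_set y.

Definition cardinal (k : V) : Prop :=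
  ordinal k /\ forall a, a ∈ k -> ~~ (elts k #<= elts a).

Definition omega1 : set V := [set a | ordinal a /\ countable (elts a)].

Definition regular_uncountable (k : V) : Prop :=
  [/\ cardinal k, ~ countable (elts k) &
      forall (a : V) (f : V -> V), a ∈ k -> (forall x, x ∈ a -> f x ∈ k) ->
        exists2 b, b ∈ k & forall x, x ∈ a -> f x ∈ b].

Definition trcl (x : V) : set V := [set y | clos_trans V mem y x].

Definition Hset (theta : V) : set V := [set x | ~~ (elts theta #<= trcl x)].

Definition much_less (X theta : V) : Prop := Hset theta (pow (pow X)).

Inductive fml : Type :=
| FEq of nat & nat
| FMem of nat & nat
| FImp of fml & fml
| FNot of fml
| FAll of fml.

Definition scons (x : V) (e : nat -> V) (n : nat) : V :=
  if n is m.+1 then e m else x.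

(** Variables are de Bruijn indices. *)
Fixpoint sat (D : set V) (e : nat -> V) (phi : fml) : Prop :=
  match phi with
  | FEq i j => e i = e j
  | FMem i j => e i ∈ e j
  | FImp a b => sat D e a -> sat D e b
  | FNot a => ~ sat D e a
  | FAll a => forall x, D x -> sat D (scons x e) a
  end.

Definition elementary (M H : set V) : Prop :=
  M `<=` H /\
  forall (phi : fml) (e : nat -> V), (forall i, M (e i)) ->
    (sat M e phi <-> sat H e phi).

Definition function (f : V) : Prop :=
  (forall z, z ∈ f -> exists a b, z = opair a b) /\
  (forall a b c, opair a b ∈ f -> opair a c ∈ f -> b = c).

(** Used only for [x] a condition of a forcing whose code is in [M], so that [x]
    belongs to an element of [M]. *)
Definition Hull (M : set V) (x : V) : set V :=
  [set y | exists f, [/\ M f, function f & opair x y ∈ f]].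

Definition parallel_omega1 (x : V) (M : set V) : Prop :=
  Hull M x `&` omega1 = M `&` omega1.

Definition club_omega1 (C : set V) : Prop :=
  [/\ C `<=` omega1,
      forall a, omega1 a -> exists2 b, C b & a ∈ b &
      forall a, omega1 a -> (exists b, b ∈ a) ->
        (forall b, b ∈ a -> exists c, [/\ C c, b ∈ c & c ∈ a]) -> C a].

Definition stationary_omega1 (S : set V) : Prop :=
  S `<=` omega1 /\ forall C, club_omega1 C -> S `&` C !=set0.

Definition ctbl_subsets (H : set V) : set (set V) :=
  [set M | M `<=` H /\ M #= [set: nat]].

Definition club_ctbl (H : set V) (C : set (set V)) : Prop :=
  [/\ C `<=` ctbl_subsets H,
      forall M, ctbl_subsets H M -> exists2 N, C N & M `<=` N &
      forall u : nat -> set V, (forall n, C (u n)) ->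
        (forall n, u n `<=` u n.+1) -> C (\bigcup_n u n)].

Definition stationary_ctbl (H : set V) (Z : set (set V)) : Prop :=
  Z `<=` ctbl_subsets H /\ forall C, club_ctbl H C -> Z `&` C !=set0.

Definition projective_stationary (H : set V) (Z : set (set V)) : Prop :=
  Z `<=` ctbl_subsets H /\
  forall S, stationary_omega1 S ->
    stationary_ctbl H [set M | Z M /\ exists2 d, S d & M `&` omega1 = elts d].

Record forcing := Forcing {
  cond : V;
  order : V;
  order_sub : forall z, z ∈ order ->
    exists p q, [/\ p ∈ cond, q ∈ cond & z = opair p q];
  order_refl : forall p, p ∈ cond -> opair p p ∈ order;
  order_trans : forall p q r,
    opair p q ∈ order -> opair q r ∈ order -> opair p r ∈ order
}.

Definition fle (P : forcing) (p q : V) : Prop := opair p q ∈ order P.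

Definition compatible (P : forcing) (p q : V) : Prop :=
  exists2 r, fle P r p & fle P r q.

Definition code (P : forcing) : V := opair (cond P) (order P).

Definition strongly_semigeneric (P : forcing) (M : set V) (ps : V) : Prop :=
  ps ∈ cond P /\
  forall q, fle P q ps ->
    exists t, [/\ t ∈ cond P, parallel_omega1 t M &
      forall r, Hull M t r -> r ∈ cond P -> fle P r t -> compatible P r q].

Definition strongly_semiproper (P : forcing) (M : set V) : Prop :=
  forall p, p ∈ cond P -> M p ->
    exists2 ps, fle P ps p & strongly_semigeneric P M ps.

(** "Sufficiently large" is read as "from some [theta0] on"; this is implied by
    the reading "for all regular uncountable [theta >> P]". *)
Definition strongly_ssp (P : forcing) : Prop :=
  exists2 theta0, ordinal theta0 &
    forall theta, regular_uncountable theta -> theta0 ∈ theta ->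
      much_less (cond P) theta ->
      projective_stationary (Hset theta)
        [set M | [/\ ctbl_subsets (Hset theta) M, elementary M (Hset theta),
                     M (code P) & strongly_semiproper P M]].

(** A [P]-name is a small family of pairs (name, condition of [P]).  A
    statement of the forcing language is represented by the set of the
    conditions forcing it; disjunctions and existential statements are forced
    when they are realised on a dense set of stronger conditions. *)

Inductive name (P : forcing) : Type :=
  Name (J : small) (x : J -> name P) (c : J -> idx (cond P)).

Definition fprop (P : forcing) := V -> Prop.

Definition fand P (A B : fprop P) : fprop P := fun p => A p /\ B p.
Definition for_ P (A B : fprop P) : fprop P :=
  fun p => forall q, fle P q p -> exists2 r, fle P r q & A r \/ B r.
Definition fimp P (A B : fprop P) : fprop P :=
  fun p => forall q, fle P q p -> A q -> B q.
Definition fiff P (A B : fprop P) : fprop P := fand (fimp A B) (fimp B A).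
Definition fall P T (A : T -> fprop P) : fprop P := fun p => forall t, A t p.
Definition fex P T (A : T -> fprop P) : fprop P :=
  fun p => forall q, fle P q p -> exists2 r, fle P r q & exists t, A t r.

Definition below P (s : idx (cond P)) : fprop P := fun p => fle P p (elt s).

Fixpoint feq P (x y : name P) {struct x} : fprop P :=
  let: Name _ f c := x in
  let: Name _ g d := y in
  fand
    (fall (fun i => fimp (below (c i))
      (fex (fun j => fand (below (d j)) (feq (f i) (g j))))))
    (fall (fun j => fimp (below (d j))
      (fex (fun i => fand (below (c i)) (feq (f i) (g j)))))).

Definition fmem P (x y : name P) : fprop P :=
  let: Name _ g d := y in fex (fun j => fand (below (d j)) (feq x (g j))).

(** The canonical name of a ground model set: [{(check y, p) : y ∈ x, p ∈ P}]. *)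
Fixpoint pcheck (P : forcing) (x : pset) : name P :=
  let: PSet A f := x in
  Name (fun ap : A * idx (cond P) => pcheck P (f ap.1)) (fun ap => ap.2).
Definition check (P : forcing) (x : V) : name P := pcheck P (repr x).

(** [A] may be a proper class, e.g. [setT] for "[x] is in [V]"; for the elements
    of a set this agrees with membership in its check name. *)
Definition fground P (A : set V) (x : name P) : fprop P :=
  fex (fun a : {a : V | A a} => feq x (check P (proj1_sig a))).

Definition fupair P (z a b : name P) : fprop P :=
  fall (fun w => fiff (fmem w z) (for_ (feq w a) (feq w b))).
Definition fopair P (z a b : name P) : fprop P :=
  fex (fun u => fex (fun v =>
    fand (fupair u a a) (fand (fupair v a b) (fupair z u v)))).

Definition fapp P (f a b : name P) : fprop P :=
  fex (fun z => fand (fopair z a b) (fmem z f)).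

Definition ffunction P (A B : set V) (f : name P) : fprop P :=
  fand (fall (fun z => fimp (fmem z f)
         (fex (fun a => fex (fun b =>
           fand (fground A a) (fand (fground B b) (fopair z a b)))))))
  (fand (fall (fun a => fimp (fground A a) (fex (fun b => fapp f a b))))
        (fall (fun a => fall (fun b => fall (fun b' =>
          fimp (fand (fapp f a b) (fapp f a b')) (feq b b')))))).

Definition frestr P (f a g : name P) : fprop P :=
  fall (fun z => fiff (fmem z g)
    (fand (fmem z f)
      (fex (fun x => fex (fun y => fand (fmem x a) (fopair z x y)))))).

(** Generic filters over the full universe [V] are not elements of [V]; "[A]
    holds in [V[G]] for every [V]-generic filter [G]" means, as usual, that
    every condition forces [A]. *)
Definition generically_true P (A : fprop P) : Prop :=
  forall p, p ∈ cond P -> A p.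

Definition no_fresh_functions (P : forcing) : Prop :=
  generically_true (fall (fun f : name P =>
    fimp (fand (ffunction omega1 setT f)
           (fall (fun a => fimp (fground omega1 a)
             (fex (fun g => fand (frestr f a g) (fground setT g))))))
         (fground setT f))).

(* Main.v *)
(** Suppose [q0] forces [f] to be a fresh function.  Then every condition [s]
    compatible with [q0] splits: there are [r0, r1 <= s] and [a] in [omega1]
    such that [r0] and [r1] force different values of [f] at [a].  Fix functions
    [s |-> r0, r1, a] and let [M] be a countable set containing them, together
    with [q0], for which the forcing is strongly semiproper.  Since the countable
    sets containing finitely many given elements form a club, such an [M] exists
    without any appeal to elementarity or to the definability of forcing.  Put
    [d = M ∩ omega1], let [ps <= q0] be strongly semigeneric, let [q <= ps]
    decide the restriction of [f] to [d], and let [t] be a trace of [q].  Then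
    [t] is compatible with [q], hence with [q0], and the values [r0, r1, a] at
    [t] lie in the hull of [M] and [t].  So [a] is in [d], and [q], which
    decides [f] at [a], is compatible with both [r0] and [r1]: a contradiction. *)

From HB Require Import structures.
From mathcomp Require Import all_boot.
From mathcomp Require Import mathcomp_extra boolp classical_sets functions cardinality.
From Stdlib Require Import Relation_Operators Operators_Properties.
Require Import Defs.

Set Implicit Arguments.
Unset Strict Implicit.
Unset Printing Implicit Defensive.

Local Open Scope classical_set_scope.
Local Open Scope card_scope.
Local Open Scope quotient_scope.

(** * Sets in [V] and regular cardinals *)

Definition family (A : small) (f : A -> V) : V :=
  \pi_V (PSet (fun a => repr (f a))).

Lemma mem_family (A : small) (f : A -> V) x : x ∈ family f <-> exists a, f a = x.
Proof.
by rewrite /family mem_pi; split=> -[a <-]; exists a; rewrite reprK.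
Qed.

Definition empty_set : V := family (False_rect V).

Lemma mem_empty x : ~ x ∈ empty_set.
Proof. by move=> /mem_family[[]]. Qed.

HB.instance Definition _ := isPointed.Build V empty_set.

Lemma upair_inj a b c d :
  upair a b = upair c d -> a = c /\ b = d \/ a = d /\ b = c.
Proof.
move=> e; have eq z : z = a \/ z = b <-> z = c \/ z = d by rewrite -!mem_upair e.
have := (eq a).1; have := (eq b).1; have := (eq c).2; have := (eq d).2.
by intuition congruence.
Qed.

Lemma opair_inj a b c d : opair a b = opair c d -> a = c /\ b = d.
Proof.
by move=> /upair_inj[] [/upair_inj h1 /upair_inj h2]; intuition congruence.
Qed.

(** Nonempty finite paths from the root: [None] stops at the chosen child, [Some] continues below
    it. The ends of the paths exhaust the transitive closure, which is thus bounded by a small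
    type. *)
Fixpoint nodes (x : pset) : small :=
  let: PSet A f := x in {a : A & option (nodes (f a))}.

Lemma trcl_nodes (x : pset) : trcl (\pi_V x) #<= [set: nodes x].
Proof.
apply/pcard_surjP; elim: x => A f IH /=; pose e a := sval (cid (IH a)).
have eP a : set_surj setT (trcl (\pi_V (f a))) (e a) := svalP (cid (IH a)).
exists (fun n => if projT2 n is Some m then e _ m else \pi_V (f (projT1 n))).
(* The membership chain is unfolded at its upper end, so that [z] is a member of the set or lies in
   the transitive closure of a member. *)
move=> z /= zx; move E: (\pi_V _) zx => x zx; have {}zx := clos_trans_tn1 _ _ _ _ zx.
case: zx E => [y zy|y {}x yx zy] E; [move: zy|move: yx]; rewrite -E => /mem_pi[a ay].
  by exists (existT _ a None).
subst y; have [m _ <-] := eP a _ (clos_tn1_trans _ _ _ _ zy).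
by exists (existT _ a (Some m)).
Qed.

(** The surjection [e] plays the role of κ·κ = κ for the size κ of [W]; this is what makes the
    successor cardinal of κ regular. *)
Lemma large_type (T : small) : inhabited T -> exists W : small,
  [/\ inhabited W, [set: T] #<= [set: W], [set: nat] #<= [set: W] &
      exists e : W -> W * option W, set_surj setT setT e].
Proof.
(* Even columns code the first component; column 1 tells whether the second is
   [None], and the columns from 3 on code its value otherwise. *)
move=> [t0]; exists (nat -> T -> Prop); split; first by constructor=> _ _; exact: True.
- apply/pcard_injP; exists (fun t _ s => s = t) => s t _ _ E.
  by have <- := congr1 (fun g : nat -> T -> Prop => g 0 s) E.
- apply/pcard_injP; exists (fun n m _ => m = n) => n m _ _ E.
  by have <- := congr1 (fun g : nat -> T -> Prop => g n t0) E.
pose e (w : nat -> T -> Prop) := (fun n => w n.*2,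
  if pselect (w 1 t0) then Some (fun n => w n.*2.+3) else None).
exists e; case=> a b _.
exists (fun n t => if odd n then
    if b is Some b' then n = 1 \/ b' n./2.-1 t else False else a n./2 t) => //.
rewrite /e/=; congr pair.
  by apply/funext=> n; apply/funext=> t; rewrite odd_double doubleK.
case: b => [b|]; last by case: pselect.
case: pselect => [h /=|ne]; last by case: ne; left.
congr Some; apply/funext=> n; apply/funext=> t; apply/propext.
by rewrite /= odd_double/= uphalf_double; split=> [[]|]//; right.
Qed.

Lemma ordinal_mem a b : ordinal a -> b ∈ a -> ordinal b.
Proof. by move=> [at_ ae] ba; split=> [|y yb]; apply: ae => //; apply: at_ yb. Qed.

Lemma Hartogs (W : small) :
  exists h : V, forall a, a ∈ h <-> ordinal a /\ elts a #<= [set: W].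
Proof.
(* An ordinal that is the image of [W] under [e] is determined by the relation
   and the domain that [e] pulls back to [W]; the type of such pairs is small. *)
pose codes (c : (W -> W -> Prop) * (W -> Prop)) (a : V) := ordinal a /\
  exists e : W -> V, [/\ elts a `<=` range e,
    forall v w, c.1 v w = (e v ∈ e w) & forall w, c.2 w = (e w ∈ a)].
pose I := {c | exists a, codes c a}.
pose F (i : I) : V := proj1_sig (cid (proj2_sig i)).
exists (family F) => a; rewrite mem_family; split.
  move=> [i <-]; rewrite /F; case: cid => b /= [ordb [e [eb _ _]]]; split=> //.
  by apply/pcard_surjP; exists e.
move=> [orda /pcard_surjP[e ea]].
pose c := (fun v w => e v ∈ e w, fun w => e w ∈ a).
have ca : codes c a by split=> //; exists e.
exists (exist _ c (ex_intro _ a ca)); rewrite /F /=; case: cid => b /= [ordb [g [gb gR gS]]].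
rewrite /= in gR gS.
(* Uniqueness of the Mostowski collapse: [e] and [g] pull back the same relation and domain, so they
   agree by induction on membership. *)
have eg w : e w ∈ a -> e w = g w.
  move ex : (e w) => x; elim/(well_founded_ind mem_wf): x w ex => x IH w ewx xa; subst x.
  have gwb : g w ∈ b by rewrite -gS.
  apply: V_ext => z; split=> [zw|zw].
    have za : z ∈ a by apply: orda.1 zw.
    have [v _ vz] := ea _ za; subst z.
    by rewrite (IH _ zw v)// -gR.
  have zb : z ∈ b by apply: ordb.1 zw.
  have [v _ vz] := gb _ zb; subst z.
  have va : e v ∈ a by rewrite gS.
  have vw : e v ∈ e w by rewrite gR.
  by rewrite -(IH _ vw v).
apply: V_ext => z; split=> [zb|za].
  by have [w _ wz] := gb _ zb; subst z; rewrite -eg gS.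
by have [w _ wz] := ea _ za; subst z; rewrite eg// -gS.
Qed.

Lemma regular_Hartogs (W : small) (h : V) : inhabited W ->
  [set: nat] #<= [set: W] -> (exists e : W -> W * option W, set_surj setT setT e) ->
  (forall a, a ∈ h <-> ordinal a /\ elts a #<= [set: W]) ->
  regular_uncountable h /\ ~ (elts h #<= [set: W]).
Proof.
move=> [w0] natW [e eP] hP.
have ordh : ordinal h.
  split=> [a /hP[orda aW] b ba|a /hP[[]]//]; apply/hP; split.
    exact: ordinal_mem ba.
  by apply: card_le_trans aW; apply: subset_card_le; apply: orda.1.
(* Burali-Forti: a bound by [W] would make [h] satisfy the criterion for membership in itself. *)
have notW : ~ (elts h #<= [set: W]).
  move=> hW; have hh : h ∈ h by apply/hP.
  by elim/(well_founded_ind mem_wf): {1 2}h {-1}(hh) => x IH xx; apply: (IH x).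
split=> //; split.
- split=> // a /hP[_ aW]; apply/negP => ha; exact/notW/(card_le_trans ha).
- by move=> ch; apply/notW/(card_le_trans ch).
move=> a f /hP[orda /pcard_surjP[ea eaP]] fh.
have fW x : exists g : W -> V, x ∈ a -> elts (f x) `<=` range g.
  have [xa|//] := pselect (x ∈ a); last by exists (fun=> x).
  by have /hP[_ /pcard_surjP[g gP]] := fh _ xa; exists g.
have [g gP] := choice fW.
(* [G] maps [W] onto the union of the successors of the [f x], hence onto [b]. *)
pose G (w : W) := let x := ea (e w).1 in if (e w).2 is Some v then g x v else f x.
(* [ea] and [g] may also take values outside the sets they cover; [S] keeps only the codes with a
   legitimate value. *)
pose S := {w : W | exists2 x, x ∈ a & G w = f x \/ G w ∈ f x}.
pose b := family (fun s : S => G (sval s)).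
have bG z : z ∈ b -> exists2 w, True & G w = z.
  by move=> /mem_family[[w wS] <-]; exists w.
have bP z : z ∈ b <-> exists2 x, x ∈ a & z = f x \/ z ∈ f x.
  split=> [/mem_family[[w wS] <-]//|[x xa zx]].
  suff [w wz] : exists w, G w = z.
    by subst z; apply/mem_family; exists (exist _ w (ex_intro2 _ _ x xa zx)).
  have [u _ ux] := eaP _ xa; subst x.
  case: zx => [->|zx].
    by have [w _ wE] := eP (u, None) I; exists w; rewrite /G wE.
  have [v _ vz] := gP _ xa _ zx.
  by have [w _ wE] := eP (u, Some v) I; exists w; rewrite /G wE.
exists b; last by move=> x xa; apply/bP; exists x => //; left.
apply/hP; split; last by apply/pcard_surjP; exists G.
split=> [y /bP[x xa yx] z zy|y /bP[x xa yx]].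
  apply/bP; exists x => //; right; case: yx => [<-//|yx].
  by have /hP[[fx _] _] := fh _ xa; apply: fx yx _ zy.
have /hP[[ft fx] _] := fh _ xa.
by case: yx => [->//|]; apply: fx.
Qed.

(** Take the successor of the size of some [W] dominating the transitive closure of [z], hence that
    of each member of [z]. *)
Lemma regular_above (z : V) : exists theta : V, [/\ regular_uncountable theta,
  forall x, x ∈ z -> ordinal x -> x ∈ theta &
  forall x, x ∈ z -> Hset theta x].
Proof.
(* [option] makes the type inhabited even when [z] is empty. *)
have [] := @large_type (option (nodes (repr z))); first by constructor; exact: None.
move=> W [W0 zW natW eW]; have [h hP] := Hartogs W.
have [reg nh] := regular_Hartogs W0 natW eW hP; exists h.
have {}zW x : x ∈ z -> trcl x #<= [set: W].
  move=> xz; apply: card_le_trans zW.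
  have zn : trcl z #<= [set: nodes (repr z)] by have := trcl_nodes (repr z); rewrite reprK.
  have zo : [set: nodes (repr z)] #<= [set: option (nodes (repr z))].
    by apply: (@card_le_trans _ _ _ (some @` setT)); rewrite ?card_le_some// card_leT.
  apply: card_le_trans (card_le_trans zn zo).
  by apply: subset_card_le => y yx; apply: t_trans yx (t_step _ _ _ _ xz).
split=> // x xz => [ox|].
  apply/hP; split=> //; apply: card_le_trans (zW _ xz); apply: subset_card_le => y yx.
  exact: t_step.
by apply/negP => hx; apply/nh/(card_le_trans hx)/zW.
Qed.

(** * The forcing relation *)

Section Forcing.
Variable P : forcing.
Implicit Types (p q r s : V) (x y z w : name P) (A B : fprop P).

Lemma fle_cond p q : fle P p q -> p ∈ cond P /\ q ∈ cond P.
Proof. by move=> /order_sub[a [b [? ? /opair_inj[-> ->]]]]. Qed.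

Lemma fle_refl p : p ∈ cond P -> fle P p p.
Proof. exact: order_refl. Qed.

Lemma fle_refll p q : fle P p q -> fle P p p.
Proof. by move=> /fle_cond[/fle_refl]. Qed.

Lemma fle_trans q p r : fle P p q -> fle P q r -> fle P p r.
Proof. exact: order_trans. Qed.

Lemma below_mono (c : idx (cond P)) p q : fle P q p -> below c p -> below c q.
Proof. exact: fle_trans. Qed.

(** An arbitrary [fprop] need not pass to stronger conditions, so the witness is required to work at
    all of them. *)
Lemma fex_intro T (A : T -> fprop P) t p :
  (forall q, fle P q p -> A t q) -> fex A p.
Proof.
move=> At q qp; exists q; first exact: fle_refll qp.
by exists t; apply: At.
Qed.

Lemma fex_mono T (A : T -> fprop P) p q : fle P q p -> fex A p -> fex A q.
Proof. by move=> qp H r rq; apply: H; apply: fle_trans rq qp. Qed.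

Lemma fex_elim T (A : T -> fprop P) p : p ∈ cond P -> fex A p ->
  exists2 r, fle P r p & exists t, A t r.
Proof. by move=> /fle_refl pp; apply. Qed.

Lemma fex_local T (A : T -> fprop P) p :
  (forall q, fle P q p -> exists2 r, fle P r q & fex A r) -> fex A p.
Proof.
move=> H q /H[r rq Ar]; have [|s sr As] := fex_elim _ Ar.
  by have [] := fle_cond rq.
by exists s => //; apply: fle_trans sr rq.
Qed.

Lemma fimp_mono A B p q : fle P q p -> fimp A B p -> fimp A B q.
Proof. by move=> qp H r rq; apply: H; apply: fle_trans rq qp. Qed.

Lemma feq_mono x y p q : fle P q p -> feq x y p -> feq x y q.
Proof.
case: x y => I f c [J g d] /= qp [H1 H2].
by split=> i; apply: fimp_mono qp _; [apply: H1|apply: H2].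
Qed.

Lemma fmem_mono x y p q : fle P q p -> fmem x y p -> fmem x y q.
Proof. by case: y => J g d; apply: fex_mono. Qed.

Lemma fmem_local x y p :
  (forall q, fle P q p -> exists2 r, fle P r q & fmem x y r) -> fmem x y p.
Proof. by case: y => J g d; apply: fex_local. Qed.

Lemma feq_refl x p : feq x x p.
Proof.
elim: x p => I f IH c p /=.
split=> i q qp qc; apply: (fex_intro (t := i)) => r rq; split=> //;
  exact: below_mono rq qc.
Qed.

Lemma feq_sym x y p : feq x y p -> feq y x p.
Proof.
elim: x y p => I f IH c [J g d] p /= [H1 H2].
split=> i q qp qc r rq; [have := H2 i q qp qc r rq|have := H1 i q qp qc r rq];
  by move=> [s sr [j [sj /IH e]]]; exists s => //; exists j.
Qed.

Lemma feq_trans y x z p : feq x y p -> feq y z p -> feq x z p.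
Proof.
elim: x y z p => I f IH c [J g d] [K h e] p /= [H1 H1'] [H2 H2']; split=> i q qp qc r rq.
  have [s sr [j [sj fg]]] := H1 i q qp qc r rq.
  have sp : fle P s p by apply: fle_trans sr (fle_trans rq qp).
  have [t ts [k [tk gh]]] := H2 j s sp sj s (fle_refll sr).
  exists t; first exact: fle_trans ts sr.
  by exists k; split=> //; apply: IH gh; apply: feq_mono ts fg.
have [s sr [j [sj fg]]] := H2' i q qp qc r rq.
have sp : fle P s p by apply: fle_trans sr (fle_trans rq qp).
have [t ts [k [tk gh]]] := H1' j s sp sj s (fle_refll sr).
exists t; first exact: fle_trans ts sr.
by exists k; split=> //; apply: IH gh _; apply: feq_mono ts fg.
Qed.

Lemma fmem_eql x x' y p : feq x x' p -> fmem x y p -> fmem x' y p.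
Proof.
case: y => J g d xx' /= H q qp; have [r rq [j [rj xg]]] := H q qp.
exists r => //; exists j; split=> //; apply: feq_trans xg; apply: feq_sym.
by apply: feq_mono xx'; apply: fle_trans rq qp.
Qed.

Lemma fmem_eqr x y y' p : feq y y' p -> fmem x y p -> fmem x y' p.
Proof.
case: y y' => I f c [J g d] /= [H _] xy q qp.
have [r rq [i [ri xf]]] := xy q qp.
have [s sr [j [sj fg]]] := H i r (fle_trans rq qp) ri r (fle_refll rq).
exists s; first exact: fle_trans sr rq.
by exists j; split=> //; apply: feq_trans fg; apply: feq_mono sr xf.
Qed.

Lemma feq_ext x y p :
  (forall w q, fle P q p -> fmem w x q -> fmem w y q) ->
  (forall w q, fle P q p -> fmem w y q -> fmem w x q) -> feq x y p.
Proof.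
(* Each entry of a name is forced to be a member by any condition below its label. *)
have elem J (g : J -> name P) d j q : below (d j) q -> fmem (g j) (Name g d) q.
  move=> qj; apply: (fex_intro (t := j)) => r rq.
  by split; [apply: below_mono rq qj|apply: feq_refl].
case: x y => I f c [J g d] xy yx; split=> i q qp qi; first exact/xy/elem.
move=> r rq; have [s sr [j [sj e]]] := yx _ _ qp (elem _ _ _ _ _ qi) _ rq.
by exists s => //; exists j; split=> //; apply: feq_sym.
Qed.

(** * Check names and names of ordered pairs *)

Lemma pcheck_peq u v p : peq u v -> feq (pcheck P u) (pcheck P v) p.
Proof.
elim: u v p => A f IH [B g] p /= [H1 H2]; split=> [[a c]|[b c]] q qp /= qc.
  have [b ab] := H1 a; apply: (fex_intro (t := (b, c))) => r rq.
  by split; [apply: below_mono rq qc|apply: IH].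
have [a ab] := H2 b; apply: (fex_intro (t := (a, c))) => r rq.
by split; [apply: below_mono rq qc|apply: IH].
Qed.

Lemma feq_pcheck u v p : p ∈ cond P -> feq (pcheck P u) (pcheck P v) p -> peq u v.
Proof.
elim: u v p => A f IH [B g] p /= Pp [H1 H2].
(* A check name lists each element with every condition as label; [c] is the index of [p] itself, so
   [p] forces the entries labelled [c] to be members. *)
have pp := fle_refl Pp; have [c cp] := Pp.
have pc : below c p by rewrite /below cp.
split=> [a|b].
  have [r rp [[b d] [_ e]]] := H1 (a, c) p pp pc p pp.
  by exists b; apply: IH e; have [] := fle_cond rp.
have [r rp [[a d] [_ e]]] := H2 (b, c) p pp pc p pp.
by exists a; apply: IH e; have [] := fle_cond rp.
Qed.

Lemma check_inj (a b : V) p :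
  p ∈ cond P -> feq (check P a) (check P b) p -> a = b.
Proof. by move=> Pp /(feq_pcheck Pp)/pi_peq; rewrite !reprK. Qed.

Lemma fmem_check x (a b : V) p : a ∈ b -> feq x (check P a) p -> fmem x (check P b) p.
Proof.
rewrite /check -{1}[b]reprK; case: (repr b) => B g /mem_pi[i <-] xa q qp.
have [_ /= [c cp]] := fle_cond qp.
exists q; first exact: fle_refll qp.
exists (i, c); split=> /=; first by rewrite /below cp.
apply: feq_trans (pcheck_peq _ (peq_repr _)); exact: feq_mono qp xa.
Qed.

Lemma fmem_checkE x (b : V) p : p ∈ cond P -> fmem x (check P b) p ->
  exists2 r, fle P r p & exists2 a, a ∈ b & feq x (check P a) r.
Proof.
rewrite /check -{2}[b]reprK; case: (repr b) => B g Pp /(fex_elim Pp).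
move=> [r rp [[i c] /= [_ e]]]; exists r => //; exists (\pi_V (g i)).
  by apply/mem_pi; exists i.
by apply: feq_trans e _; apply/pcheck_peq/peq_sym/peq_repr.
Qed.

Lemma fmem_check_check (a b : V) p :
  p ∈ cond P -> fmem (check P a) (check P b) p -> a ∈ b.
Proof.
move=> Pp /(fmem_checkE Pp)[r rp [c cb]].
by move=> /check_inj ->//; have [] := fle_cond rp.
Qed.

Lemma fupair_check z x y (a b : V) p :
  feq x (check P a) p -> feq y (check P b) p -> fupair z x y p ->
  feq z (check P (upair a b)) p.
Proof.
move=> xa yb zxy; apply: feq_ext => w q qp wz.
  apply: fmem_local => q' q'q.
  have [r rq' H] := (zxy w).1 q qp wz q' q'q; exists r => //.
  have rp : fle P r p := fle_trans rq' (fle_trans q'q qp).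
  have {}e : feq w (check P a) r \/ feq w (check P b) r.
    by case: H => e; [left|right]; apply: feq_trans e (feq_mono rp _).
  by case: e; apply: fmem_check; apply/mem_upair; [left|right].
apply: (zxy w).2 => // q' q'q; have [Pq' _] := fle_cond q'q.
have [r rq' [c H wc]] := fmem_checkE Pq' (fmem_mono q'q wz).
have rp : fle P r p := fle_trans rq' (fle_trans q'q qp).
exists r => //; move: H wc => /mem_upair[->|->] wc; [left|right];
  apply: feq_trans wc _; apply: feq_sym; exact: feq_mono rp _.
Qed.

Lemma fupair_checks (a b : V) p :
  fupair (check P (upair a b)) (check P a) (check P b) p.
Proof.
move=> w; split=> q qp H.
  move=> q' q'q; have [Pq' _] := fle_cond q'q.
  have [r rq' [c ab wc]] := fmem_checkE Pq' (fmem_mono q'q H).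
  by exists r => //; move: ab wc => /mem_upair[->|->]; [left|right].
apply: fmem_local => q' /H[r rq' e]; exists r => //.
by case: e; apply: fmem_check; apply/mem_upair; [left|right].
Qed.

Lemma fopair_check z x y (a b : V) p : p ∈ cond P ->
  feq x (check P a) p -> feq y (check P b) p -> fopair z x y p ->
  exists2 r, fle P r p & feq z (check P (opair a b)) r.
Proof.
move=> Pp xa yb /(fex_elim Pp)[q qp [u H]].
have [Pq _] := fle_cond qp.
have [r rq [v [uxx [vxy zuv]]]] := fex_elim Pq H.
have rp := fle_trans rq qp; exists r => //.
have xa' := feq_mono rp xa; have yb' := feq_mono rp yb.
by apply: fupair_check zuv; [apply: fupair_check uxx|apply: fupair_check vxy].
Qed.

Lemma fopair_checks (a b : V) p :
  fopair (check P (opair a b)) (check P a) (check P b) p.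
Proof.
apply: (fex_intro (t := check P (upair a a))) => q _.
apply: (fex_intro (t := check P (upair a b))) => r _.
by split; [|split]; apply: fupair_checks.
Qed.

(** As [y] is any name, [z] cannot be compared with a check pair directly. Instead, the singleton of
    [a] is forced to be one of the two elements of [opair b c]; both contain [b], so [b] is [a]. *)
Lemma fopair_fst z y (a b c : V) p : p ∈ cond P ->
  fopair z (check P a) y p -> feq z (check P (opair b c)) p -> a = b.
Proof.
move=> Pp /(fex_elim Pp)[q qp [u H]] zbc.
have [Pq _] := fle_cond qp.
have [r rq [v [uaa [_ zuv]]]] := fex_elim Pq H.
have rr := fle_refll rq; have [Pr _] := fle_cond rr.
have uz : fmem u z r.
  apply: (zuv u).2 => // s sr; exists s; first exact: fle_refll sr.
  by left; apply: feq_refl.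
have {}uz := fmem_eqr (feq_mono (fle_trans rq qp) zbc) uz.
have [s sr [d dbc ud]] := fmem_checkE Pr uz.
have bd : b ∈ d by move/mem_upair: dbc => [->|->]; apply/mem_upair; left.
have bu : fmem (check P b) u s.
  by apply: (fmem_eqr (feq_sym ud)); apply: fmem_check bd (feq_refl _ _).
have ss := fle_refll sr.
have [t ts e] := (uaa (check P b)).1 s sr bu s ss.
have [Pt _] := fle_cond ts.
by case: e => /(check_inj Pt).
Qed.

Lemma fground_check (A : set V) a p : A a -> fground A (check P a) p.
Proof.
by move=> Aa; apply: (fex_intro (t := exist _ a Aa)) => q _; apply: feq_refl.
Qed.

(** * Names of functions from [omega1] to the ground model *)

Section Function.
Variables (f : name P) (p : V).
Hypothesis f_fun : ffunction omega1 setT f p.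

(** This is [r] forcing f(a) = b. Using the check name of the pair instead of [fapp] avoids a
    quantifier over names of pairs. *)
Definition value r (a b : V) : Prop := fmem (check P (opair a b)) f r.

Lemma fmem_function x q : fle P q p -> fmem x f q -> exists2 r, fle P r q &
  exists a b, omega1 a /\ feq x (check P (opair a b)) r.
Proof.
move=> qp xf; have qq := fle_refll qp; have [Pq _] := fle_cond qq.
have [r rq [a H]] := f_fun.1 x q qp xf q qq.
have [Pr _] := fle_cond rq.
have [s sr [b [ga [gb xab]]]] := fex_elim Pr H.
have [Ps _] := fle_cond sr.
have [t ts [[a' a'1] /= aa']] := fex_elim Ps ga.
have [Pt _] := fle_cond ts.
have [t' t't [[b' ?] /= bb']] := fex_elim Pt (fex_mono ts gb).
have [Pt' _] := fle_cond t't.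
have t's := fle_trans t't ts.
have [v vt' e] := fopair_check Pt' (feq_mono t't aa') bb' (fex_mono t's xab).
exists v; last by exists a', b'.
exact: fle_trans vt' (fle_trans t's (fle_trans sr rq)).
Qed.

Lemma value_total q (a : V) : fle P q p -> omega1 a ->
  exists2 r, fle P r q & exists b, value r a b.
Proof.
move=> qp a1; have qq := fle_refll qp; have [Pq _] := fle_cond qq.
have [r rq [b H]] := f_fun.2.1 (check P a) q qp (fground_check a1) q qq.
have [Pr _] := fle_cond rq.
have [s sr [z [zab zf]]] := fex_elim Pr H.
have sp := fle_trans sr (fle_trans rq qp).
have [t ts [a' [b' [_ e]]]] := fmem_function sp zf.
have [Pt _] := fle_cond ts.
have aa' := fopair_fst Pt (fex_mono ts zab) e; subst a'.
exists t; first exact: fle_trans ts (fle_trans sr rq).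
by exists b'; apply: fmem_eql e _; apply: fmem_mono zf.
Qed.

Lemma value_mono q r (a b : V) : fle P r q -> value q a b -> value r a b.
Proof. exact: fmem_mono. Qed.

Lemma value_inj q (a b b' : V) : fle P q p -> value q a b -> value q a b' -> b = b'.
Proof.
move=> qp ab ab'; have [Pq _] := fle_cond qp.
have app c : value q a c -> fapp f (check P a) (check P c) q.
  move=> ac; apply: (fex_intro (t := check P (opair a c))) => r rq.
  by split; [apply: fopair_checks|apply: value_mono ac].
by apply: (check_inj Pq); apply: f_fun.2.2 qp _; split; apply: app.
Qed.

(** A condition decides the restriction to [d] as a ground model set [g]. By the two clauses
    together, a value at a point of [d] forced by any extension of [r] is already forced by [r]. *)
Lemma value_restr q (d : V) : fle P q p -> omega1 d ->
  fall (fun a => fimp (fground omega1 a)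
    (fex (fun g => fand (frestr f a g) (fground setT g)))) p ->
  exists2 r, fle P r q & exists g : V,
    (forall s a b, fle P s r -> a ∈ d -> value s a b -> opair a b ∈ g) /\
    (forall a b, opair a b ∈ g -> value r a b).
Proof.
move=> qp d1 /(_ (check P d) q qp (fground_check d1)) H.
have [Pq _] := fle_cond qp.
have [r rq [g [fdg gV]]] := fex_elim Pq H.
have [Pr _] := fle_cond rq.
have [s sr [[g' ?] /= gg']] := fex_elim Pr gV.
exists s; first exact: fle_trans sr rq.
exists g'; split=> [t a b ts ad tab|a b abg].
  have [Pt _] := fle_cond ts; apply: (fmem_check_check Pt).
  apply: fmem_eqr (feq_mono ts gg') _.
  apply: (fdg (check P (opair a b))).2; first exact: fle_trans ts sr.
  split=> //; apply: (fex_intro (t := check P a)) => v _.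
  apply: (fex_intro (t := check P b)) => v' _.
  by split; [apply: fmem_check ad (feq_refl _ _)|apply: fopair_checks].
have /= := (fdg (check P (opair a b))).1 s sr; case=> //.
by apply: (fmem_eqr (feq_sym gg')); apply: fmem_check abg (feq_refl _ _).
Qed.

(** If conditions below [s] never disagreed, the values they force would form a ground model
    function [h], and [s] would force [f] to equal its graph. *)
Lemma value_split s : fle P s p ->
  (forall r g, fle P r s -> ~ feq f (check P g) r) ->
  exists r0 r1 a b0 b1, [/\ fle P r0 s, fle P r1 s, omega1 a, b0 <> b1 &
    value r0 a b0 /\ value r1 a b1].
Proof.
move=> sp fV; apply: contrapT => nsplit.
have vuniq a b b' r r' : fle P r s -> fle P r' s -> omega1 a ->
    value r a b -> value r' a b' -> b = b'.
  move=> rs r's a1 vb vb'; apply: contrapT => bb'; apply: nsplit.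
  by exists r, r', a, b, b'.
(* [w1] has exactly the elements of the class [omega1]; indexing by it makes the graph of [h] a
   set. *)
have [w1 w1P] := Hartogs nat.
have bP (a : V) : exists b, omega1 a -> exists2 r, fle P r s & value r a b.
  have [a1|na] := pselect (omega1 a); last by exists a.
  by have [r rs [b vb]] := value_total sp a1; exists b => _; exists r.
have [h hP] := choice bP.
pose g := family (fun i : idx w1 => opair (elt i) (h (elt i))).
have gP (z : V) : z ∈ g <-> exists2 a, omega1 a & z = opair a (h a).
  rewrite mem_family; split=> [[i <-]|[a /w1P[i <-] ->]]; last by exists i.
  by exists (elt i) => //; apply/w1P; exists i.
apply: (fV s g); first exact: fle_refll sp.
apply: feq_ext => w q qs wf; apply: fmem_local => q' q'q.
  have q's := fle_trans q'q qs; have q'p := fle_trans q's sp.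
  have [r rq' [a [b [a1 wab]]]] := fmem_function q'p (fmem_mono q'q wf).
  have rab : value r a b.
    by apply: fmem_eql wab _; apply: fmem_mono wf; apply: fle_trans rq' q'q.
  exists r => //; apply: fmem_check wab; apply/gP; exists a => //.
  have [r' r's vr'] := hP _ a1; congr opair.
  by apply: vuniq rab vr' => //; apply: fle_trans rq' q's.
(* Conversely, a pair of [g] lies in [f]: a value forced further down must be the one chosen by
   [h]. *)
have [Pq' _] := fle_cond q'q.
have [r rq' [z /gP[a a1 ->] wa]] := fmem_checkE Pq' (fmem_mono q'q wf).
have rs := fle_trans rq' (fle_trans q'q qs).
have [t tr [b vb]] := value_total (fle_trans rs sp) a1.
have [r' r's vr'] := hP _ a1.
have eb := vuniq _ _ _ _ _ r's (fle_trans tr rs) a1 vr' vb.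
exists t; first exact: fle_trans tr rq'.
by apply: fmem_eql vb; apply: feq_sym; rewrite -eb; apply: feq_mono wa.
Qed.

End Function.
End Forcing.

(** * Countable models *)

(** Cutting a Rocq function down to a set makes it an element of [V], so that a countable model can
    contain it and [Hull] can apply it. *)
Definition graph (X : V) (g : V -> V) : V :=
  family (fun i : idx X => opair (elt i) (g (elt i))).

Lemma mem_graph X g x y : opair x y ∈ graph X g <-> x ∈ X /\ y = g x.
Proof.
rewrite mem_family; split=> [[i /opair_inj[<- <-]]|[[i <-] ->]]; last by exists i.
by split=> //; exists i.
Qed.

Lemma function_graph X g : function (graph X g).
Proof.
split=> [z /mem_family[i <-]|a b c /mem_graph[_ ->] /mem_graph[_ ->]//].
by exists (elt i), (g (elt i)).
Qed.

Lemma Hull_graph M X g x : M (graph X g) -> x ∈ X -> Hull M x (g x).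
Proof.
by move=> Mg xX; exists (graph X g); split=> //; [apply: function_graph|apply/mem_graph].
Qed.

Lemma ctbl_subsetsP (H M : set V) :
  ctbl_subsets H M <-> [/\ M `<=` H, countable M & [set: nat] #<= M].
Proof.
rewrite /ctbl_subsets /= card_eq_le; split=> [[MH /andP[? ?]]|[? ? ?]] //.
by split=> //; apply/andP.
Qed.

Lemma club_superset (H A : set V) : A `<=` H -> countable A ->
  club_ctbl H [set M | ctbl_subsets H M /\ A `<=` M].
Proof.
move=> AH cA; split=> [M []//|M /ctbl_subsetsP[MH cM iM]|u uC _].
  exists (M `|` A); last by move=> x Mx; left.
  split; last by move=> x Ax; right.
  apply/ctbl_subsetsP; split=> [x [/MH|/AH]//||].
    by rewrite -bigcup2E; apply: bigcup_countable => // -[|[|n]] _; last exact: countable0.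
  by apply: card_le_trans iM _; apply: subset_card_le => x; left.
split; last by move=> x Ax; exists 0 => //; apply: (uC 0).2.
apply/ctbl_subsetsP; split.
- by move=> x [n _ /((uC n).1.1)].
- apply: bigcup_countable => // n _; by have [/ctbl_subsetsP[]] := uC n.
- have [/ctbl_subsetsP[_ _ i0] _] := uC 0; apply: card_le_trans i0 _.
  by apply: subset_card_le => x u0x; exists 0.
Qed.

(** Projective stationarity is applied to this set; it supplies the ordinal [d] with M ∩ ω1 = d. *)
Lemma stationary_omega1T : stationary_omega1 omega1.
Proof.
split=> // C [C1 Cunb _].
have [|b Cb _] := Cunb empty_set; last by exists b; split=> //; apply: C1.
split; first by split=> y /mem_empty.
by rewrite (_ : elts _ = set0)// -subset0 => y /mem_empty.
Qed.

Lemma strongly_ssp_model (P : forcing) (z : V) : strongly_ssp P ->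
  countable (elts z) -> exists M d,
    [/\ omega1 d, M `&` omega1 = elts d, elts z `<=` M & strongly_semiproper P M].
Proof.
move=> [theta0 otheta0 ssp] cz.
have [theta [reg mem_theta Htheta]] :=
  (* The three kinds of index put [theta0] below [theta], make [theta] large for [P], and put the
     elements of [z] into [Hset theta]. *)
  regular_above (family (fun i : option (option (idx z)) => match i with
    | None => theta0 | Some None => pow (pow (cond P)) | Some (Some i) => elt i end)).
have [|| _ /(_ _ stationary_omega1T)[_ stat]] := ssp theta reg.
- by apply: mem_theta => //; apply/mem_family; exists None.
- by apply: Htheta; apply/mem_family; exists (Some None).
have zH : elts z `<=` Hset theta.
  by move=> x [i <-]; apply: Htheta; apply/mem_family; exists (Some (Some i)).
have [M [[[_ _ _ MP] [d d1 Md]] [_ zM]]] := stat _ (club_superset zH cz).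
by exists M, d.
Qed.

Theorem lemma3p5 (P : forcing) : strongly_ssp P -> no_fresh_functions P.
Proof.
move=> ssp p0 Pp0 f p pp0 [f_fun f_restr] q0 q0p; apply: contrapT => nV.
have fV r (g : V) : fle P r q0 -> ~ feq f (check P g) r.
  by move=> rq0 e; apply: nV; exists r => //; exists (exist _ g I).
pose split3 (s : V) (F : V * V * V) := exists b0 b1,
  [/\ fle P F.1.1 s, fle P F.1.2 s, omega1 F.2, b0 <> b1 &
      value f F.1.1 F.2 b0 /\ value f F.1.2 F.2 b1].
(* If [s] is incompatible with [q0], the triple is a default. Otherwise a common extension is split,
   which also splits [s]. *)
have ex3 s : exists F, compatible P s q0 -> split3 s F.
  have [[u us uq0]|nc] := pselect (compatible P s q0); last by exists (s, s, s).
  have [r g ru|r0 [r1 [a [b0 [b1 [r0u r1u a1 bb vs]]]]]] :=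
    value_split f_fun (fle_trans uq0 q0p).
    by apply: fV; apply: fle_trans ru uq0.
  by exists (r0, r1, a) => _; exists b0, b1; split=> //; apply: fle_trans us.
have [F FP] := choice ex3.
have [Pq0 _] := fle_cond q0p.
(* Position 0, the identity, puts [t] into its own hull, so that [t] is compatible with [q];
   positions 1 to 3 give the two conditions and the ordinal, and position 4 is [q0]. *)
pose l := [:: graph (cond P) id; graph (cond P) (fun s => (F s).1.1);
  graph (cond P) (fun s => (F s).1.2); graph (cond P) (fun s => (F s).2); q0].
pose z := family (fun n : nat => nth empty_set l n).
have cz : countable (elts z).
  apply: card_le_trans (card_image_le (nth empty_set l) setT).
  by apply: subset_card_le => x /mem_family[n <-]; exists n.
have [M [d [d1 Md zM MP]]] := strongly_ssp_model ssp cz.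
have lM n : M (nth empty_set l n) by apply: zM; apply/mem_family; exists n.
have [ps psq0 [Pps semi]] := MP _ Pq0 (lM 4).
have [q qps [g [gv vg]]] := value_restr (fle_trans psq0 q0p) d1 f_restr.
have [t [Pt tM tq]] := semi q qps.
have [u ut uq] := tq t (Hull_graph (lM 0) Pt) Pt (fle_refl Pt).
have qq0 := fle_trans qps psq0.
have [|b0 [b1 [r0t r1t a1 bb [v0 v1]]]] := FP t.
  by exists u => //; apply: fle_trans uq qq0.
have ad : (F t).2 ∈ d.
  suff : elts d (F t).2 by [].
  rewrite -Md -tM; split=> //; exact: Hull_graph (lM 3) Pt.
(* A common extension [v] of [r] and [q] inherits the value from [r]; the value is thereby recorded
   in [g], hence forced by [q] itself. *)
have decided r b : Hull M t r -> fle P r t -> value f r (F t).2 b ->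
    value f q (F t).2 b.
  move=> Hr rt vr; have [Pr _] := fle_cond rt.
  have [v vr' vq] := tq r Hr Pr rt.
  by apply: vg; apply: gv vq ad _; apply: value_mono vr.
apply: bb; apply: (value_inj f_fun (fle_trans qq0 q0p)).
  by apply: decided v0 => //; apply: Hull_graph (lM 1) Pt.
by apply: decided v1 => //; apply: Hull_graph (lM 2) Pt.
Qed.
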